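(* Let $K>0$ and let $a=(a_k)_{k\in\mathbb{N}}\in\ell^\infty$ be such that $|a_k|\le K$ for all $k\in\mathbb{N}$ and $$\lim_{n\to\infty}\ \sup_{j\in\mathbb{N}}\ \frac1n\sum_{k=1}^{n}|a_{k+j-1}|=K .$$ Then $W(T_a)=\{z\in\mathbb{C} : |z|<K\}$.
   Context: $\mathbb{N}=\{1,2,3,\dots\}$. $\ell^2$ is the complex Hilbert space of square-summable unilateral sequences $(x_k)_{k\in\mathbb{N}}$, and $\ell^\infty$ the space of bounded complex sequences. For $a\in\ell^\infty$, the (unilateral) weighted forward shift $T_a:\ell^2\to\ell^2$ is the bounded operator $T_a(x_1,x_2,\dots)=(0,a_1x_1,a_2x_2,\dots)$. The numerical range of a bounded operator $T$ on a complex Hilbert space $H$ is $W(T)=\{\langle Tx,x\rangle : x\in H,\ \|x\|=1\}$. *)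

(* Defs.v *)
From Stdlib Require Import Reals Lra Psatz.
From Coquelicot Require Import Coquelicot.

Open Scope R_scope.

(** Sequences indexed by [{1, 2, 3, ...}] are represented by functions on
    [nat], the value at [k] being the term of index [k + 1]. *)

Record linf : Type := mk_linf {
  linf_seq :> nat -> C;
  linf_bounded : exists M : R, forall k : nat, Cmod (linf_seq k) <= M
}.

Record l2 : Type := mk_l2 {
  l2_seq :> nat -> C;
  l2_summable : ex_series (fun k : nat => Cmod (l2_seq k) ^ 2)
}.

Definition l2_norm (x : l2) : R := sqrt (Series (fun k : nat => Cmod (x k) ^ 2)).

(** Coquelicot's total sum [Series] is only available for real series, hence
    the real and imaginary parts; [is_series_l2_inner] shows that this is the
    sum in [C] of the series of the [x k * Cconj (y k)]. *)
Definition l2_inner (x y : l2) : C :=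
  (Series (fun k : nat => Re (x k * Cconj (y k))%C),
   Series (fun k : nat => Im (x k * Cconj (y k))%C)).

Lemma is_series_C (u : nat -> C) (l : C) :
  is_series u l ->
  is_series (fun k => Re (u k)) (Re l) /\ is_series (fun k => Im (u k)) (Im l).
Proof.
  intros H.
  assert (E : forall n,
    sum_n u n = (sum_n (fun k => Re (u k)) n, sum_n (fun k => Im (u k)) n)).
  { induction n as [|n IH].
    - rewrite !sum_O. now destruct (u O).
    - rewrite !sum_Sn, IH. reflexivity. }
  split; intros P [eps HP]; destruct (H (ball l eps) (locally_ball l eps)) as [N HN];
    exists N; intros n Hn; apply HP; specialize (HN n Hn); rewrite E in HN;
    destruct HN as [H1 H2]; assumption.
Qed.

Lemma is_series_l2_inner (x y : l2) :
  is_series (fun k : nat => (x k * Cconj (y k))%C) (l2_inner x y).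
Proof.
  assert (H : ex_series (fun k : nat => (x k * Cconj (y k))%C)).
  { apply (@ex_series_le _ C_CompleteNormedModule)
      with (b := fun k => Cmod (x k) ^ 2 + Cmod (y k) ^ 2).
    - intros n. change (Cmod (x n * Cconj (y n)) <= Cmod (x n) ^ 2 + Cmod (y n) ^ 2).
      rewrite Cmod_mult, Cmod_conj. nra.
    - apply (@ex_series_plus _ R_NormedModule); apply l2_summable. }
  destruct H as [l Hl]. destruct (is_series_C _ _ Hl) as [H1 H2].
  unfold l2_inner. rewrite (is_series_unique _ _ H1), (is_series_unique _ _ H2).
  now destruct l.
Qed.

Definition shift_seq (a x : nat -> C) (k : nat) : C :=
  match k with
  | O => RtoC 0
  | S m => (a m * x m)%C
  end.

Lemma shift_seq_summable (a : linf) (x : l2) :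
  ex_series (fun k : nat => Cmod (shift_seq a x k) ^ 2).
Proof.
  destruct (linf_bounded a) as [M HM].
  apply ex_series_incr_1.
  apply (@ex_series_le _ R_CompleteNormedModule)
    with (b := fun k => M ^ 2 * Cmod (x k) ^ 2).
  - intros n. change (Rabs (Cmod (a n * x n) ^ 2) <= M ^ 2 * Cmod (x n) ^ 2).
    rewrite Cmod_mult, Rabs_pos_eq by apply pow2_ge_0.
    rewrite Rpow_mult_distr. apply Rmult_le_compat_r; [apply pow2_ge_0|].
    apply pow_incr. split; [apply Cmod_ge_0 | apply HM].
  - apply (@ex_series_scal R_AbsRing R_NormedModule (M ^ 2)), l2_summable.
Qed.

Definition weighted_shift (a : linf) (x : l2) : l2 :=
  mk_l2 (shift_seq a x) (shift_seq_summable a x).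

Lemma weighted_shift_bounded (a : linf) (M : R) :
  (forall k : nat, Cmod (a k) <= M) ->
  forall x : l2, l2_norm (weighted_shift a x) <= M * l2_norm x.
Proof.
  intros HM x.
  assert (M0 : 0 <= M) by (apply Rle_trans with (2 := HM O); apply Cmod_ge_0).
  unfold l2_norm. rewrite <- (sqrt_pow2 M M0) at 1.
  rewrite <- sqrt_mult_alt by apply pow2_ge_0.
  apply sqrt_le_1_alt.
  rewrite Series_incr_1 by apply l2_summable.
  replace (Cmod (weighted_shift a x O) ^ 2) with 0
    by (simpl; rewrite Cmod_0; ring).
  rewrite Rplus_0_l, <- Series_scal_l.
  apply Series_le.
  - intros n. split; [apply pow2_ge_0|]. simpl weighted_shift.
    change (Cmod (a n * x n) ^ 2 <= M ^ 2 * Cmod (x n) ^ 2).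
    rewrite Cmod_mult, Rpow_mult_distr. apply Rmult_le_compat_r; [apply pow2_ge_0|].
    apply pow_incr. split; [apply Cmod_ge_0 | apply HM].
  - apply (@ex_series_scal R_AbsRing R_NormedModule (M ^ 2)), l2_summable.
Qed.

Definition numerical_range (T : l2 -> l2) (z : C) : Prop :=
  exists x : l2, l2_norm x = 1 /\ z = l2_inner (T x) x.

(** Mean of the [n + 1] consecutive terms [|a j|, ..., |a (j + n)|]. *)
Definition window_mean (a : nat -> C) (n j : nat) : R :=
  sum_n (fun k : nat => Cmod (a (k + j)%nat)) n / INR (S n).

(** [Sup_seq] takes values in [Rbar]; [real] loses nothing here, since the
    window means of a bounded sequence are bounded. *)
Definition sup_window_mean (a : linf) (n : nat) : R :=
  real (Sup_seq (fun j : nat => Finite (window_mean a n j))).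

Lemma is_sup_window_mean (a : linf) (n : nat) :
  is_sup_seq (fun j : nat => Finite (window_mean a n j))
             (Finite (sup_window_mean a n)).
Proof.
  destruct (linf_bounded a) as [M HM].
  assert (B : forall j, 0 <= window_mean a n j <= M).
  { intros j. assert (P : 0 < INR (S n)) by (apply lt_0_INR; apply Nat.lt_0_succ).
    assert (Q : 0 <= sum_n (fun k => Cmod (a (k + j)%nat)) n <= INR (S n) * M).
    { clear P. induction n as [|m IH].
      - rewrite sum_O. simpl INR. rewrite Rmult_1_l.
        split; [apply Cmod_ge_0 | apply HM].
      - rewrite sum_Sn, (S_INR (S m)). change plus with Rplus; cbv beta.
        pose proof (HM (S m + j)%nat). pose proof (Cmod_ge_0 (a (S m + j)%nat)). lra. }
    unfold window_mean. split.
    - apply Rdiv_le_0_compat; lra.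
    - apply Rle_div_l; lra. }
  pose proof (Sup_seq_correct (fun j : nat => Finite (window_mean a n j))) as H.
  unfold sup_window_mean.
  assert (F : is_finite (Sup_seq (fun j : nat => Finite (window_mean a n j)))).
  { apply is_finite_correct.
    destruct (Sup_seq (fun j : nat => Finite (window_mean a n j))) as [r| |].
    - now exists r.
    - destruct (H M) as [j Hj]. simpl in Hj. pose proof (B j). lra.
    - pose proof (H 0 O) as Hj. simpl in Hj. pose proof (B O). lra. }
  now rewrite F.
Qed.

(* Main.v *)
Require Import Defs.
From Stdlib Require Import Reals Lra Lia.
From Coquelicot Require Import Coquelicot.

(** For a unit vector [x] write [p k = |x k|]. Since [T_a] moves the entry [k]
    to the entry [k + 1], the form [<T_a x, x>] is the sum of the
    [a k * x k * conj (x (k + 1))], and both inclusions are statements about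
    the sum of the [p k * p (k + 1)].

    The modulus of the form is at most [K] times that sum, and the sum is
    strictly below [1]: the identity
    [2 * sum p k p (k+1) = 2 - p 0 ^ 2 - sum (p k - p (k+1)) ^ 2] shows that
    equality would make [p] constant and equal to [p 0 = 0]
    ([adjacent_product_lt_1]). So the range lies in the open disc.

    Conversely the phases of the [x k] can be chosen one after the other, so
    that every summand points in a prescribed direction [w]
    ([numerical_range_direction]); it remains to find a real unit sequence [p]
    with [sum |a k| p k p (k+1)] equal to a prescribed [r < K]. A vector
    constant on [n + 2] consecutive indices gives [(n+1)/(n+2)] times the mean
    of [n + 1] consecutive [|a k|], and by hypothesis some such value exceeds
    [r]. To obtain [r] itself, part of the mass is moved to one index not
    adjacent to the window: this keeps the norm and multiplies the form by the
    fraction of the squared norm that stays ([real_form_attains]). *)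

(** * Sums of series *)

Lemma Cmod_is_series_le (u : nat -> C) (v : nat -> R) (l : C) (L : R) :
  (forall k, Cmod (u k) <= v k) -> is_series u l -> is_series v L -> Cmod l <= L.
Proof.
  intros Huv Hu Hv.
  assert (Hn : is_lim_seq (fun n => Cmod (sum_n u n)) (Cmod l)).
  { apply (filterlim_comp _ _ _ (sum_n u) Cmod _ (locally l) _ Hu).
    exact (@filterlim_norm C_AbsRing C_NormedModule l). }
  refine (is_lim_seq_le _ _ (Finite (Cmod l)) (Finite L) _ Hn Hv).
  intros n. induction n as [|n IH].
  - rewrite !sum_O. apply Huv.
  - rewrite !sum_Sn. eapply Rle_trans; [apply Cmod_triangle|].
    apply Rplus_le_compat; [exact IH | apply Huv].
Qed.

Lemma nonneg_term_le_series (f : nat -> R) (l : R) :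
  (forall k, 0 <= f k) -> is_series f l -> forall k, f k <= l.
Proof.
  intros Hf Hl k.
  assert (Hk : f k <= sum_n f k).
  { destruct k as [|k]; [rewrite sum_O; lra|].
    rewrite sum_Sn.
    assert (H : 0 <= sum_n f k).
    { induction k as [|k IH]; [rewrite sum_O; apply Hf|].
      rewrite sum_Sn. apply Rplus_le_le_0_compat; [exact IH | apply Hf]. }
    change (f (S k) <= sum_n f k + f (S k)). lra. }
  apply Rle_trans with (1 := Hk).
  apply (is_lim_seq_incr_compare (sum_n f) l Hl).
  intros n. rewrite sum_Sn.
  change (sum_n f n <= sum_n f n + f (S n)). pose proof (Hf (S n)). lra.
Qed.

Lemma is_series_window (f : nat -> R) (j n : nat) :
  (forall k, (k < j)%nat -> f k = 0) ->
  (forall k, (j + n < k)%nat -> f k = 0) ->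
  is_series f (sum_n (fun k => f (k + j)%nat) n).
Proof.
  revert f. induction j as [|j IH]; intros f Hlow Hhigh.
  - assert (Hc : forall m, sum_n f (m + n) = sum_n (fun k => f (k + 0)%nat) n).
    { induction m as [|m IHm].
      - apply sum_n_ext. intros k. now rewrite Nat.add_0_r.
      - simpl Nat.add. rewrite sum_Sn, IHm, Hhigh by lia. apply Rplus_0_r. }
    change (is_lim_seq (sum_n f) (sum_n (fun k => f (k + 0)%nat) n)).
    apply (is_lim_seq_incr_n _ n).
    eapply is_lim_seq_ext; [intros m; symmetry; apply Hc | apply is_lim_seq_const].
  - apply is_series_decr_1. rewrite (Hlow O) by lia.
    match goal with |- is_series _ ?l =>
      replace l with (sum_n (fun k => f (S (k + j))) n) end.
    + apply (IH (fun k => f (S k))); intros k Hk; [apply Hlow | apply Hhigh]; lia.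
    + change (sum_n (fun k => f (S (k + j))) n
              = sum_n (fun k => f (k + S j)%nat) n + - 0).
      rewrite Ropp_0, Rplus_0_r. apply sum_n_ext.
      intros k. now rewrite Nat.add_succ_r.
Qed.

(** * The numerical range lies in the open disc *)

(** The first entry of [T_a x] vanishes, so the inner product can be summed
    over the edges [(k, k + 1)] rather than over the indices. *)
Lemma weighted_shift_form (a : linf) (x : l2) :
  is_series (fun k => a k * x k * Cconj (x (S k)))%C
            (l2_inner (weighted_shift a x) x).
Proof.
  pose proof (is_series_l2_inner (weighted_shift a x) x) as H.
  apply (is_series_incr_1 (fun k => (weighted_shift a x k * Cconj (x k))%C)).
  match goal with |- is_series _ ?l =>
    replace l with (l2_inner (weighted_shift a x) x); [exact H|] end.
  change (l2_inner (weighted_shift a x) x =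
    (l2_inner (weighted_shift a x) x + RtoC 0 * Cconj (x O))%C).
  ring.
Qed.

(** Twice the sum is [2 - p 0 ^ 2] minus the sum of the squares
    [(p k - p (k + 1)) ^ 2]. If it reached [2], all these terms would vanish,
    and [p] would be identically zero, against the unit norm. *)
Lemma adjacent_product_lt_1 (p : nat -> R) :
  is_series (fun k => p k ^ 2) 1 ->
  exists L, is_series (fun k => p k * p (S k)) L /\ L < 1.
Proof.
  intros Hp.
  assert (Hs : is_series (fun k => p (S k) ^ 2) (1 - p O ^ 2)).
  { apply (is_series_incr_1 (fun k => p k ^ 2)).
    match goal with |- is_series _ ?l => replace l with 1; [exact Hp|] end.
    change (1 = 1 - p O ^ 2 + p O ^ 2). ring. }
  assert (Hsum : is_series (fun k => p k ^ 2 + p (S k) ^ 2) (1 + (1 - p O ^ 2)))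
    by exact (is_series_plus _ _ _ _ Hp Hs).
  assert (Hex : ex_series (fun k => p k * p (S k))).
  { apply (@ex_series_le R_AbsRing R_CompleteNormedModule)
      with (b := fun k => p k ^ 2 + p (S k) ^ 2).
    - intros k. change (Rabs (p k * p (S k)) <= p k ^ 2 + p (S k) ^ 2).
      apply Rabs_le. nra.
    - eexists; exact Hsum. }
  destruct Hex as [L HL]. exists L. split; [exact HL|].
  assert (Hd : is_series (fun k => (p k - p (S k)) ^ 2)
                         (1 + (1 - p O ^ 2) - 2 * L)).
  { eapply is_series_ext;
      [|exact (is_series_minus _ _ _ _ Hsum (is_series_scal 2 _ _ HL))].
    intros k. change (p k ^ 2 + p (S k) ^ 2 - 2 * (p k * p (S k))
                      = (p k - p (S k)) ^ 2). ring. }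
  assert (Hpart : forall k, (p k - p (S k)) ^ 2 <= 1 + (1 - p O ^ 2) - 2 * L).
  { apply nonneg_term_le_series; [intros k; apply pow2_ge_0 | exact Hd]. }
  destruct (Rlt_or_le L 1) as [|HL1]; [assumption|exfalso].
  assert (H0 : forall k, p k = 0).
  { induction k as [|k IH].
    - pose proof (Hpart O). pose proof (pow2_ge_0 (p O - p 1%nat)). nra.
    - pose proof (Hpart k) as Hk. rewrite IH in Hk.
      pose proof (pow2_ge_0 (p O)). nra. }
  (* The squares vanish off index 0, so their sum is that of the window {0}. *)
  assert (Hz : is_series (fun k => p k ^ 2) (sum_n (fun k => p (k + 0)%nat ^ 2) 0))
    by (apply (is_series_window (fun k => p k ^ 2)); intros k _; rewrite H0; ring).
  apply is_series_unique in Hz. rewrite (is_series_unique _ _ Hp), sum_O, H0 in Hz.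
  lra.
Qed.

(** * Every point of the open disc is attained *)

(** At [0] the value is [1] and not [0], because the phases built from
    vanishing weights must still be unimodular. *)
Definition direction (z : C) : C :=
  if Ceq_dec z 0 then 1%C else (z / Cmod z)%C.

Lemma Cmod_direction (z : C) : Cmod (direction z) = 1.
Proof.
  unfold direction. destruct (Ceq_dec z 0) as [_|Hz]; [apply Cmod_1|].
  assert (Hm : Cmod z <> 0) by (intros E; now apply Hz, Cmod_eq_0).
  rewrite Cmod_div by (intros E; now apply Hm, RtoC_inj).
  rewrite Cmod_R, Rabs_pos_eq by apply Cmod_ge_0. now field.
Qed.

Lemma polar_form (z : C) : z = (Cmod z * direction z)%C.
Proof.
  unfold direction. destruct (Ceq_dec z 0) as [->|Hz].
  - rewrite Cmod_0. ring.
  - field. intros E. now apply Hz, Cmod_eq_0, RtoC_inj.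
Qed.

Lemma unimodular_mult_conj (w : C) : Cmod w = 1 -> (w * Cconj w)%C = 1%C.
Proof. intros Hw. rewrite <- Cmod2_conj, Hw. now rewrite pow1. Qed.

(** Multiplying the entries of [p] by suitable phases turns each summand of the
    form into [w] times [|a k| * p k * p (k + 1)]: the phase of entry [k + 1] is
    determined by that of entry [k] and by [a k], and no constraint ever comes
    back to an earlier entry. *)
Lemma numerical_range_direction (a : linf) (p : nat -> R) (r : R) (w : C) :
  Cmod w = 1 ->
  is_series (fun k => p k ^ 2) 1 ->
  is_series (fun k => Cmod (a k) * (p k * p (S k))) r ->
  numerical_range (weighted_shift a) (r * w)%C.
Proof.
  intros Hw Hp Hr.
  set (u := fix u k := match k with
                       | O => RtoC 1
                       | S m => (u m * (direction (a m) * Cconj w))%C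
                       end).
  assert (Hu : forall k, Cmod (u k) = 1).
  { induction k as [|k IH]; [apply Cmod_1|]. simpl.
    rewrite !Cmod_mult, Cmod_conj, IH, Cmod_direction, Hw. ring. }
  assert (Hx : forall k, Cmod (p k * u k) ^ 2 = p k ^ 2).
  { intros k. rewrite Cmod_mult, Hu, Cmod_R, Rmult_1_r. apply pow2_abs. }
  assert (Hsum : is_series (fun k => Cmod (p k * u k) ^ 2) 1)
    by exact (is_series_ext _ _ _ (fun k => eq_sym (Hx k)) Hp).
  set (x := mk_l2 (fun k => (p k * u k)%C) (ex_intro _ 1 Hsum)).
  exists x. split.
  - unfold l2_norm. simpl l2_seq.
    rewrite (is_series_unique _ _ Hsum). apply sqrt_1.
  - assert (Hterm : forall k, (a k * x k * Cconj (x (S k)))%C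
                      = (RtoC (Cmod (a k) * (p k * p (S k))) * w)%C).
    { intros k. simpl. fold u.
      assert (Hreal : Cconj (p (S k)) = p (S k))
        by (unfold Cconj, RtoC; simpl; now rewrite Ropp_0).
      rewrite !Cmult_conj, Cconj_conj, Hreal.
      rewrite (polar_form (a k)) at 1. rewrite !RtoC_mult.
      transitivity (Cmod (a k) * (p k * p (S k)) * w
        * (direction (a k) * Cconj (direction (a k))) * (u k * Cconj (u k)))%C;
        [ring|].
      rewrite !unimodular_mult_conj by (apply Hu || apply Cmod_direction). ring. }
    (* The inner product is defined by its real and imaginary parts, so [w] is
       pulled out of the two real series separately. *)
    destruct (is_series_C _ _ (weighted_shift_form a x)) as [HRe HIm].
    apply is_series_unique in HRe, HIm.
    assert (E : forall k, (RtoC (Cmod (a k) * (p k * p (S k))) * w)%C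
      = (Re w * (Cmod (a k) * (p k * p (S k))),
         Im w * (Cmod (a k) * (p k * p (S k))))).
    { intros k. destruct w as [w1 w2]. unfold Cmult, RtoC; simpl. f_equal; ring. }
    rewrite (Series_ext _ (fun k => Re w * (Cmod (a k) * (p k * p (S k))))) in HRe
      by (intros k; now rewrite Hterm, E).
    rewrite (Series_ext _ (fun k => Im w * (Cmod (a k) * (p k * p (S k))))) in HIm
      by (intros k; now rewrite Hterm, E).
    rewrite Series_scal_l, (is_series_unique _ _ Hr) in HRe, HIm.
    rewrite (surjective_pairing (l2_inner _ _)).
    change (fst (l2_inner (weighted_shift a x) x))
      with (Re (l2_inner (weighted_shift a x) x)).
    change (snd (l2_inner (weighted_shift a x) x))
      with (Im (l2_inner (weighted_shift a x) x)).
    rewrite <- HRe, <- HIm. destruct w as [w1 w2].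
    unfold Cmult, RtoC; simpl. f_equal; ring.
Qed.

(** A vector with equal entries [s] on the [n + 2] indices joined by the
    [n + 1] weights of a window has form [s ^ 2 * A], where [A] is the sum of
    these weights in modulus. Hence [s ^ 2 = r / A] gives the value [r]; the
    squared norm so used is at most [1] as soon as [r * (n + 2) < A], which the
    hypothesis on the means provides because [(n + 1) / (n + 2)] tends to [1].
    The rest of the squared norm goes to one entry [c] placed beyond a zero entry,
    where it meets no neighbour and leaves the form unchanged. *)
Lemma real_form_attains (K r : R) (a : linf) :
  is_lim_seq (sup_window_mean a) K -> 0 <= r < K ->
  exists p : nat -> R, is_series (fun k => p k ^ 2) 1 /\
    is_series (fun k => Cmod (a k) * (p k * p (S k))) r.
Proof.
  intros Hlim Hr.
  assert (Hratio : is_lim_seq (fun n => INR (S n) / INR (S (S n))) 1).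
  { apply is_lim_seq_ext with (fun n => 1 - / INR (S (S n))).
    - intros n. rewrite (S_INR (S n)). pose proof (pos_INR (S n)). field. lra.
    - replace (Finite 1) with (Finite (1 - 0)) by (f_equal; ring).
      apply is_lim_seq_minus'; [apply is_lim_seq_const|].
      apply (is_lim_seq_inv _ p_infty); [|discriminate].
      exact (proj1 (is_lim_seq_incr_1 _ _) (proj1 (is_lim_seq_incr_1 _ _)
               is_lim_seq_INR)). }
  pose proof (is_lim_seq_mult' _ _ _ _ Hratio Hlim) as Hprod.
  rewrite Rmult_1_l in Hprod.
  assert (Hwin : exists n j,
    r * INR (S (S n)) < sum_n (fun k => Cmod (a (k + j)%nat)) n).
  { assert (Hgap : 0 < K - r) by lra.
    destruct (proj2 (is_lim_seq_spec _ _) Hprod (mkposreal _ Hgap)) as [n Hn].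
    specialize (Hn n (le_n n)). simpl pos in Hn. apply Rabs_def2 in Hn.
    exists n.
    assert (P1 : 0 < INR (S n)) by (apply lt_0_INR; lia).
    assert (P2 : 0 < INR (S (S n))) by (apply lt_0_INR; lia).
    assert (Hsup : r * INR (S (S n)) / INR (S n) < sup_window_mean a n).
    { apply Rlt_div_l; [exact P1|].
      replace (sup_window_mean a n * INR (S n)) with
        (INR (S n) / INR (S (S n)) * sup_window_mean a n * INR (S (S n)))
        by (field; lra).
      apply Rmult_lt_compat_r; lra. }
    assert (Heps : 0 < sup_window_mean a n - r * INR (S (S n)) / INR (S n)) by lra.
    destruct (proj2 (is_sup_window_mean a n (mkposreal _ Heps))) as [j Hj].
    change (sup_window_mean a n - (sup_window_mean a n - r * INR (S (S n)) / INR (S n))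
            < window_mean a n j) in Hj.
    exists j. apply Rmult_lt_reg_r with (/ INR (S n)); [now apply Rinv_0_lt_compat|].
    change (r * INR (S (S n)) / INR (S n) < window_mean a n j). lra. }
  destruct Hwin as (n & j & Hnj).
  set (A := sum_n (fun k => Cmod (a (k + j)%nat)) n) in *.
  assert (P2 : 0 < INR (S (S n))) by (apply lt_0_INR; lia).
  assert (HA : 0 < A).
  { apply Rle_lt_trans with (2 := Hnj). apply Rmult_le_pos; lra. }
  assert (Hs2 : 0 <= r / A) by (apply Rdiv_le_0_compat; lra).
  assert (Hc2 : 0 <= 1 - INR (S (S n)) * (r / A)).
  { apply Rge_le, Rge_minus, Rle_ge.
    replace (INR (S (S n)) * (r / A)) with (r * INR (S (S n)) / A) by (field; lra).
    apply Rle_div_l; lra. }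
  set (s := sqrt (r / A)). set (c := sqrt (1 - INR (S (S n)) * (r / A))).
  assert (Hs : s * s = r / A) by (apply sqrt_sqrt; exact Hs2).
  assert (Hc : c * c = 1 - INR (S (S n)) * (r / A)) by (apply sqrt_sqrt; exact Hc2).
  (* The window occupies j, ..., j + n + 1, and the zero entry at j + n + 2
     separates it from the spare mass at j + n + 3. *)
  set (p := fun k => if (k <? j)%nat then 0 else if (k <=? j + n + 1)%nat then s
                     else if (k =? j + n + 3)%nat then c else 0).
  assert (Hp0 : forall k, (k < j)%nat -> p k = 0).
  { intros k Hk. unfold p. now rewrite (proj2 (Nat.ltb_lt k j) Hk). }
  assert (Hps : forall k, (j <= k <= j + n + 1)%nat -> p k = s).
  { intros k Hk. unfold p. rewrite (proj2 (Nat.ltb_ge k j)) by lia.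
    now rewrite (proj2 (Nat.leb_le k _)) by lia. }
  assert (Hpc : p (j + n + 3)%nat = c).
  { unfold p. rewrite (proj2 (Nat.ltb_ge _ j)) by lia.
    rewrite (proj2 (Nat.leb_gt _ (j + n + 1))) by lia. now rewrite Nat.eqb_refl. }
  assert (Hpe : forall k, (j + n + 1 < k)%nat -> k <> (j + n + 3)%nat -> p k = 0).
  { intros k Hk Hk'. unfold p. rewrite (proj2 (Nat.ltb_ge k j)) by lia.
    rewrite (proj2 (Nat.leb_gt _ (j + n + 1))) by lia.
    now rewrite (proj2 (Nat.eqb_neq k _) Hk'). }
  exists p. split.
  - replace 1 with (sum_n (fun k => p (k + j)%nat ^ 2) (S (S (S n)))).
    + apply (is_series_window (fun k => p k ^ 2)); intros k Hk;
        [rewrite Hp0 by lia | rewrite Hpe by lia]; ring.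
    + rewrite !sum_Sn.
      rewrite (sum_n_ext_loc _ (fun _ => s ^ 2)) by
        (intros k Hk; rewrite Hps by lia; reflexivity).
      rewrite sum_n_const.
      replace (S (S (S n)) + j)%nat with (j + n + 3)%nat by lia.
      rewrite Hpc, (Hps (S n + j)%nat), (Hpe (S (S n) + j)%nat) by lia.
      change (INR (S n) * s ^ 2 + s ^ 2 + 0 ^ 2 + c ^ 2 = 1).
      rewrite (S_INR (S n)), <- Hs in Hc.
      transitivity ((INR (S n) + 1) * (s * s) + c * c); [ring | rewrite Hc; ring].
  - replace r with (sum_n (fun k => Cmod (a (k + j)%nat) *
                     (p (k + j)%nat * p (S (k + j)))) n).
    + apply (is_series_window (fun k => Cmod (a k) * (p k * p (S k)))); intros k Hk.
      * rewrite (Hp0 k) by lia. ring.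
      * destruct (Nat.eq_dec k (j + n + 3)) as [->|Hk'].
        -- rewrite (Hpe (S (j + n + 3))) by lia. ring.
        -- destruct (Nat.eq_dec k (j + n + 1)) as [->|Hk''].
           ++ rewrite (Hpe (S (j + n + 1))) by lia. ring.
           ++ rewrite (Hpe k) by lia. ring.
    + rewrite (sum_n_ext_loc _ (fun k => r / A * Cmod (a (k + j)%nat))).
      * change (sum_n (fun k => scal (r / A) (Cmod (a (k + j)%nat))) n = r).
        rewrite sum_n_scal_l. change (r / A * A = r). field. lra.
      * intros k Hk. rewrite !Hps by lia. rewrite Hs. apply Rmult_comm.
Qed.

Theorem corollary2p10 :
  forall (K : R) (a : linf),
    (0 < K)%R ->
    (forall k : nat, (Cmod (a k) <= K)%R) ->
    is_lim_seq (sup_window_mean a) (Finite K) ->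
    forall z : C, numerical_range (weighted_shift a) z <-> (Cmod z < K)%R.
Proof.
  intros K a HK Ha Hlim z. split.
  - intros (x & Hx & ->).
    assert (Hp : is_series (fun k => Cmod (x k) ^ 2) 1).
    { replace 1 with (Series (fun k => Cmod (x k) ^ 2)).
      - apply Series_correct, l2_summable.
      - unfold l2_norm in Hx. apply (f_equal (fun t => t * t)) in Hx.
        rewrite sqrt_sqrt in Hx; [lra|].
        apply Rle_trans with (Cmod (x O) ^ 2); [apply pow2_ge_0|].
        apply (nonneg_term_le_series (fun k => Cmod (x k) ^ 2));
          [intros k; apply pow2_ge_0 | apply Series_correct, l2_summable]. }
    destruct (adjacent_product_lt_1 _ Hp) as (L & HL & HL1).
    apply Rle_lt_trans with (K * L); [|nra].
    refine (Cmod_is_series_le _ _ _ _ _ (weighted_shift_form a x)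
              (is_series_scal K _ _ HL)).
    intros k. rewrite !Cmod_mult, Cmod_conj.
    change (Cmod (a k) * Cmod (x k) * Cmod (x (S k))
            <= K * (Cmod (x k) * Cmod (x (S k)))).
    rewrite Rmult_assoc. apply Rmult_le_compat_r; [|apply Ha].
    apply Rmult_le_pos; apply Cmod_ge_0.
  - intros Hz.
    destruct (real_form_attains K (Cmod z) a Hlim) as (p & Hp & Hr).
    { split; [apply Cmod_ge_0 | exact Hz]. }
    rewrite (polar_form z).
    apply numerical_range_direction with p; [apply Cmod_direction | exact Hp | exact Hr].
Qed.
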